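(* Let $p$ be a prime, let $G$ be a finite $p$-group and let $k$ be a field of characteristic $p$. If the generating hypothesis holds for $kG$, then the functor $\widehat{H}^*(G,-)$ from $\mathrm{stmod}(kG)$ to the category of graded modules over the graded ring $\widehat{H}^*(G,k)$ is full.
   Context: All modules over $kG$ are left modules. For a finite group $G$ and a field $k$, the stable module category $\mathrm{StMod}(kG)$ has as objects the $kG$-modules, and its morphism spaces are $\underline{\mathrm{Hom}}_{kG}(M,N)$, the $k$-vector space of $kG$-module homomorphisms $M\to N$ modulo those that factor through a projective $kG$-module. $\mathrm{stmod}(kG)$ is the category defined in the same way using only finite-dimensional $kG$-modules. $\Omega M$ denotes the kernel of a surjection from a projective module onto $M$; $\Omega$ is a self-equivalence of the stable category (the desuspension), so $\Omega^i$ is defined for all $i\in\mathbb{Z}$. Tate cohomology is $\widehat{H}^i(G,M)\cong\underline{\mathrm{Hom}}_{kG}(\Omega^i k,M)$, $i\in\mathbb{Z}$, where $k$ is the trivial $kG$-module. $\widehat{H}^*(G,k)$ is a graded ring under composition, and $\widehat{H}^*(G,M)$ is a graded module over it: for $g\in\underline{\mathrm{Hom}}_{kG}(\Omega^i k,M)$ and $f\in\underline{\mathrm{Hom}}_{kG}(\Omega^j k,k)$, the element $g\cdot f$ is $g\circ\Omega^i f\in\underline{\mathrm{Hom}}_{kG}(\Omega^{i+j}k,M)$. Morphisms of graded modules are the degree-preserving module homomorphisms. A map $\phi\colon M\to N$ is a ''ghost'' if the induced map $\underline{\mathrm{Hom}}_{kG}(\Omega^i k,M)\to\underline{\mathrm{Hom}}_{kG}(\Omega^i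 k,N)$ is zero for every $i\in\mathbb{Z}$. For a finite $p$-group $G$ and a field $k$ of characteristic $p$, the generating hypothesis for $kG$ (or for $G$) is the statement that every ghost between finite-dimensional $kG$-modules is zero in $\mathrm{stmod}(kG)$, i.e. factors through a projective. *)

(* Defs.v *)
From HB Require Import structures.
From mathcomp Require Import all_boot all_order all_fingroup all_algebra.
From mathcomp Require Import all_solvable generic_quotient boolp.

Set Implicit Arguments.
Unset Strict Implicit.
Unset Printing Implicit Defensive.

Import GRing.Theory.
Local Open Scope ring_scope.
Local Open Scope quotient_scope.

(* The group algebra kG: functions G -> k under convolution.  The alias keeps
   it apart from the pointwise ring structure carried by {ffun G -> k}. *)
Definition grpalg (k : fieldType) (G : finGroupType) : Type :=
  {ffun G -> k^o}.

Section GroupAlgebra.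
Variables (k : fieldType) (G : finGroupType).
Notation kG := (grpalg k G).

HB.instance Definition _ := GRing.Lmodule.copy kG {ffun G -> k^o}.

Definition grpalg_one : kG := [ffun g => (g == 1%g)%:R].

Definition grpalg_mul (a b : kG) : kG :=
  [ffun g => \sum_(h : G) a h * b (h^-1 * g)%g].

Fact grpalg_mulA : associative grpalg_mul.
Proof.
move=> a b c; apply/ffunP => g; rewrite !ffunE.
under eq_bigr => h _ do rewrite ffunE mulr_sumr.
under [RHS]eq_bigr => h _ do rewrite ffunE mulr_suml.
rewrite [RHS]exchange_big /=; apply: eq_bigr => l _.
rewrite [RHS](reindex_inj (mulgI l)) /=; apply: eq_bigr => m _.
by rewrite mulKg invMg mulgA mulrA.
Qed.

Fact grpalg_mul1l : left_id grpalg_one grpalg_mul.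
Proof.
move=> a; apply/ffunP => g; rewrite ffunE (bigD1 1%g) //= big1 => [|h hN1].
  by rewrite ffunE eqxx mul1r invg1 mul1g addr0.
by rewrite ffunE (negPf hN1) mul0r.
Qed.

Fact grpalg_mul1r : right_id grpalg_one grpalg_mul.
Proof.
move=> a; apply/ffunP => g; rewrite ffunE (bigD1 g) //= big1 => [|h hNg].
  by rewrite ffunE mulVg eqxx mulr1 addr0.
by rewrite ffunE -eq_mulVg1 (negPf hNg) mulr0.
Qed.

Fact grpalg_mulDl : left_distributive grpalg_mul +%R.
Proof.
move=> a b c; apply/ffunP => g; rewrite !ffunE -big_split /=.
by apply: eq_bigr => h _; rewrite ffunE mulrDl.
Qed.

Fact grpalg_mulDr : right_distributive grpalg_mul +%R.
Proof.
move=> a b c; apply/ffunP => g; rewrite !ffunE -big_split /=.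
by apply: eq_bigr => h _; rewrite ffunE mulrDr.
Qed.

Fact grpalg_one_neq0 : grpalg_one != 0.
Proof.
by apply/eqP => /ffunP/(_ 1%g)/eqP; rewrite !ffunE eqxx oner_eq0.
Qed.

HB.instance Definition _ := GRing.Zmodule_isNzRing.Build kG
  grpalg_mulA grpalg_mul1l grpalg_mul1r grpalg_mulDl grpalg_mulDr
  grpalg_one_neq0.

Fact grpalg_scaleAl (c : k) (a b : kG) : c *: (a * b) = (c *: a) * b.
Proof.
apply/ffunP => g; rewrite !ffunE scaler_sumr.
by apply: eq_bigr => h _; rewrite ffunE -scalerAl.
Qed.

HB.instance Definition _ :=
  GRing.Lmodule_isLalgebra.Build k kG grpalg_scaleAl.

End GroupAlgebra.

(* The trivial module k, on which every element of G acts as the identity. *)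
Definition trivmod (k : fieldType) (G : finGroupType) : Type := k.

Section TrivialModule.
Variables (k : fieldType) (G : finGroupType).
Notation kG := (grpalg k G).

HB.instance Definition _ := GRing.Zmodule.on (trivmod k G).

Definition triv_scale (a : kG) (c : trivmod k G) : trivmod k G :=
  (\sum_(g : G) a g) * c.

Fact triv_scaleA a b c : triv_scale a (triv_scale b c) = triv_scale (a * b) c.
Proof.
rewrite /triv_scale mulrA; congr (_ * c).
under [RHS]eq_bigr => g _ do rewrite ffunE.
rewrite exchange_big /= mulr_suml; apply: eq_bigr => h _.
rewrite -mulr_sumr; congr (_ * _).
by rewrite [RHS](reindex_inj (mulgI h)); apply: eq_bigr => g _; rewrite mulKg.
Qed.

Fact triv_scale1 : left_id 1 triv_scale.
Proof.
move=> c; rewrite /triv_scale (bigD1 1%g) //= big1 => [|h hN1].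
  by rewrite ffunE eqxx addr0 mul1r.
by rewrite ffunE (negPf hN1).
Qed.

Fact triv_scaleDr : right_distributive triv_scale +%R.
Proof. by move=> a c d; rewrite /triv_scale mulrDr. Qed.

Fact triv_scaleDl c : {morph triv_scale^~ c : a b / a + b}.
Proof.
move=> a b; rewrite /triv_scale -mulrDl -big_split /=; congr (_ * c).
by apply: eq_bigr => g _; rewrite ffunE.
Qed.

HB.instance Definition _ := GRing.Zmodule_isLmodule.Build kG (trivmod k G)
  triv_scaleA triv_scale1 triv_scaleDr triv_scaleDl.

End TrivialModule.

Section PairInjections.
Variables (R : nzRingType) (M N : lmodType R).

Definition pair_inl (x : M) : M * N := (x, 0).
Definition pair_inr (y : N) : M * N := (0, y).

Fact pair_inl_linear : linear pair_inl.
Proof.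
by move=> c x y; apply: injective_projections; rewrite //= scaler0 addr0.
Qed.
Fact pair_inr_linear : linear pair_inr.
Proof.
by move=> c x y; apply: injective_projections; rewrite //= scaler0 addr0.
Qed.

HB.instance Definition _ :=
  GRing.isLinear.Build R M (M * N)%type *:%R pair_inl pair_inl_linear.
HB.instance Definition _ :=
  GRing.isLinear.Build R N (M * N)%type *:%R pair_inr pair_inr_linear.

End PairInjections.

Section Modules.
Variables (k : fieldType) (G : finGroupType).
Notation kG := (grpalg k G).

(* Finite-dimensional over k: spanned over k by a finite family; the scalar
   c : k acts on a kG-module as c%:A = c *: 1 : kG. *)
Definition findim (M : lmodType kG) : Prop :=
  exists (n : nat) (v : 'I_n -> M),
    forall x : M, exists c : 'I_n -> k, x = \sum_(i < n) (c i)%:A *: v i.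

Record fdmod : Type := FdMod { fd_sort :> lmodType kG; fd_findim : findim fd_sort }.

Definition projective (P : lmodType kG) : Prop :=
  forall (A B : lmodType kG) (e : {linear A -> B}) (h : {linear P -> B}),
    (forall b, exists a, e a = b) -> exists l : {linear P -> A}, e \o l =1 h.

Lemma findim_trivmod : findim (trivmod k G).
Proof.
exists 1%N, (fun=> 1 : trivmod k G) => x; exists (fun=> x).
rewrite big_ord1 /GRing.scale /= /triv_scale mulr1 (bigD1 1%g) //= big1.
  by rewrite !ffunE eqxx addr0 /GRing.scale /= mulr1.
by move=> h hN1; rewrite !ffunE (negPf hN1) scaler0.
Qed.

Definition triv : fdmod := FdMod findim_trivmod.

Lemma findim_pair (M N : lmodType kG) :
  findim M -> findim N -> findim (M * N)%type.
Proof.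
move=> [m [v vP]] [n [w wP]].
pose f (s : 'I_m + 'I_n) : M * N :=
  match s with inl i => (v i, 0) | inr j => (0, w j) end.
exists (m + n)%N, (fun i => f (split i)) => -[x y].
have [c ->] := vP x; have [d ->] := wP y.
exists (fun i => match split i with inl i => c i | inr j => d j end).
rewrite big_split_ord /=.
under [X in _ = X + _]eq_bigr => i _ do rewrite (unsplitK (inl i)).
under [X in _ = _ + X]eq_bigr => i _ do rewrite (unsplitK (inr i)).
have sum1 n' (F : 'I_n' -> M * N) : (\sum_i F i).1 = \sum_i (F i).1.
  exact: (big_morph fst).
have sum2 n' (F : 'I_n' -> M * N) : (\sum_i F i).2 = \sum_i (F i).2.
  exact: (big_morph snd).
apply: injective_projections => /=.
  by rewrite !sum1 /= [X in _ = _ + X]big1 ?addr0 // => i _; rewrite scaler0.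
by rewrite !sum2 /= [X in _ = X + _]big1 ?add0r // => i _; rewrite scaler0.
Qed.

Definition fdpair (M N : fdmod) : fdmod :=
  FdMod (findim_pair (fd_findim M) (fd_findim N)).

Lemma projective_pair (P Q : lmodType kG) :
  projective P -> projective Q -> projective (P * Q)%type.
Proof.
move=> Pproj Qproj A B e h esurj.
have [l1 l1P] := Pproj A B e (h \o @pair_inl _ P Q) esurj.
have [l2 l2P] := Qproj A B e (h \o @pair_inr _ P Q) esurj.
exists ((l1 \o fst) \+ (l2 \o snd)) => -[x y] /=.
rewrite raddfD; move: (l1P x) (l2P y) => /= -> ->; rewrite -raddfD; congr (h _).
by apply: injective_projections; rewrite /= ?addr0 ?add0r.
Qed.

End Modules.

(* Homomorphisms of kG-modules as an additive group. *)
Section Hom.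
Variables (R : nzRingType) (M N : lmodType R).

Definition hom : Type := {linear M -> N}.

HB.instance Definition _ := gen_eqMixin hom.
HB.instance Definition _ := gen_choiceMixin hom.

Lemma hom_ext (f g : hom) : (f : M -> N) =1 (g : M -> N) -> f = g.
Proof.
case: f g => [f [[[f0 fD]] [fZ]]] [g [[[g0 gD]] [gZ]]] /= /funext fg; subst g.
by rewrite (Prop_irrelevance f0 g0) (Prop_irrelevance fD gD)
           (Prop_irrelevance fZ gZ).
Qed.

Definition hom_zero : hom := \0.
Definition hom_opp (f : hom) : hom := \- f.
Definition hom_add (f g : hom) : hom := f \+ g.

Fact hom_addA : associative hom_add.
Proof. by move=> f g h; apply: hom_ext => x /=; rewrite addrA. Qed.
Fact hom_addC : commutative hom_add.
Proof. by move=> f g; apply: hom_ext => x /=; rewrite addrC. Qed.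
Fact hom_add0 : left_id hom_zero hom_add.
Proof. by move=> f; apply: hom_ext => x /=; rewrite add0r. Qed.
Fact hom_addN : left_inverse hom_zero hom_opp hom_add.
Proof. by move=> f; apply: hom_ext => x /=; rewrite addNr. Qed.

HB.instance Definition _ :=
  GRing.isZmodule.Build hom hom_addA hom_addC hom_add0 hom_addN.

End Hom.

Section StableCategory.
Variables (k : fieldType) (G : finGroupType).
Notation kG := (grpalg k G).
Notation fdmod := (fdmod k G).

Definition factors_through_projective (M N : fdmod) (f : hom M N) : Prop :=
  exists P : fdmod, projective P /\
    exists (a : {linear M -> P}) (b : {linear P -> N}), f =1 b \o a.

Definition stably_trivial (M N : fdmod) : {pred hom M N} :=
  fun f => `[< factors_through_projective f >].

Fact stably_trivial_closed (M N : fdmod) : zmod_closed (@stably_trivial M N).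
Proof.
split=> [|f g /asboolP[P [Pp [a [b ab]]]] /asboolP[Q [Qp [c [d cd]]]]].
  have fd0 : findim ('rV[kG]_0 : lmodType kG).
    exists 0%N, (fun=> 0) => x; exists (fun=> 0).
    by rewrite big_ord0; apply: thinmx0.
  apply/asboolP; exists (FdMod fd0); split; last by exists \0, \0.
  by move=> A B e h _; exists \0 => x /=; rewrite (thinmx0 x) !raddf0.
apply/asboolP; exists (fdpair P Q); split; first exact: projective_pair.
exists ((@pair_inl _ P Q \o a) \+ (@pair_inr _ P Q \o c)).
exists ((b \o fst) \- (d \o snd)) => x /=.
by rewrite addr0 add0r; congr (_ - _); [exact: ab | exact: cd].
Qed.

HB.instance Definition _ (M N : fdmod) :=
  GRing.isZmodClosed.Build (hom M N) (@stably_trivial M N)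
    (@stably_trivial_closed M N).

(* Morphisms in stmod(kG). *)
Definition shom (M N : fdmod) : zmodType := Quotient.quot (@stably_trivial M N).

Definition stable (M N : fdmod) (f : {linear M -> N}) : shom M N :=
  \pi_(shom M N) (f : hom M N).

Definition scomp (L M N : fdmod) (y : shom M N) (x : shom L M) : shom L N :=
  stable ((repr y : {linear M -> N}) \o (repr x : {linear L -> M})).

Lemma stableE (M N : fdmod) (f g : {linear M -> N}) :
  stable f = stable g <-> factors_through_projective ((f : hom M N) - (g : hom M N)).
Proof.
split=> [/eqP|fg]; first by rewrite -Quotient.idealrBE => /asboolP.
by apply/eqP; rewrite -Quotient.idealrBE; apply/asboolP.
Qed.

Lemma scompE (L M N : fdmod) (g : {linear M -> N}) (f : {linear L -> M}) :
  scomp (stable g) (stable f) = stable (g \o f).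
Proof.
pose g' : {linear M -> N} := repr (stable g).
pose f' : {linear L -> M} := repr (stable f).
have gg' : stable g' = stable g by exact: reprK.
have ff' : stable f' = stable f by exact: reprK.
have <- : stable (g' \o f) = stable (g \o f).
  have /stableE[P [Pp [a [b ab]]]] := gg'.
  apply/stableE; exists P; split=> //; exists (a \o f), b => x.
  exact: ab (f x).
have /stableE[P [Pp [a [b ab]]]] := ff'.
apply/stableE; exists P; split=> //; exists a, (g' \o b) => x.
by rewrite /= -[b (a x)]ab [RHS]raddfB.
Qed.

Definition short_exact (A P B : lmodType kG)
    (i : {linear A -> P}) (q : {linear P -> B}) : Prop :=
  [/\ injective i,
      forall x, q x = 0 <-> exists a, i a = x
    & forall b, exists x, q x = b].

(* A choice of Omega^i k for every integer i: an isomorphism Omega^0 k ~ k and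
   short exact sequences 0 -> Omega^(i+1) k -> P_i -> Omega^i k -> 0 with P_i
   projective, i.e. a complete resolution of k. *)
Record syzygies : Type := Syzygies {
  syz : int -> fdmod;
  syz0 : {linear syz 0 -> triv k G};
  syz0_bij : bijective syz0;
  cover : int -> fdmod;
  cover_proj : forall i, projective (cover i);
  syz_inc : forall i, {linear syz (i + 1) -> cover i};
  syz_prj : forall i, {linear cover i -> syz i};
  syz_exact : forall i, short_exact (syz_inc i) (syz_prj i)
}.

Section Tate.
Variable W : syzygies.

(* y = Omega x: some representatives of y and x extend to a morphism of the
   chosen short exact sequences.  As kG is self-injective, x and y determine
   each other. *)
Definition is_Omega (a b : int) (x : shom (syz W a) (syz W b))
    (y : shom (syz W (a + 1)) (syz W (b + 1))) : Prop :=
  exists (f : {linear syz W a -> syz W b})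
         (h : {linear cover W a -> cover W b})
         (g : {linear syz W (a + 1) -> syz W (b + 1)}),
    [/\ x = stable f, y = stable g,
        h \o syz_inc W a =1 syz_inc W b \o g
      & f \o syz_prj W a =1 syz_prj W b \o h].

Definition tate (M : fdmod) (i : int) : zmodType := shom (syz W i) M.

(* is_Omega_pow f (i + j) i x says that x = Omega^i f, for i any integer: the
   class x is reached from f : Omega^j k -> k = Omega^0 k by applying Omega
   and its inverse. *)
Inductive is_Omega_pow (j : int) (f : tate (triv k G) j) :
    forall a b : int, shom (syz W a) (syz W b) -> Prop :=
| Omega_pow_zero (x : shom (syz W j) (syz W 0)) :
    scomp (stable (syz0 W)) x = f -> is_Omega_pow f x
| Omega_pow_succ a b (x : shom (syz W a) (syz W b)) y :
    is_Omega x y -> is_Omega_pow f x -> is_Omega_pow f y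
| Omega_pow_pred a b (x : shom (syz W a) (syz W b)) y :
    is_Omega x y -> is_Omega_pow f y -> is_Omega_pow f x.

(* Degree-preserving homomorphisms H^*(G,M) -> H^*(G,N) of graded
   H^*(G,k)-modules: phi (g . f) = phi g . f, where g . f = g \o Omega^i f. *)
Record graded_hom (M N : fdmod) : Type := GradedHom {
  graded_fun :> forall i, {additive tate M i -> tate N i};
  graded_act : forall (i j : int) (g : tate M i) (f : tate (triv k G) j)
      (x : shom (syz W (i + j)) (syz W i)), is_Omega_pow f x ->
    graded_fun (i + j) (scomp g x) = scomp (graded_fun i g) x
}.

Definition ghost (M N : fdmod) (f : shom M N) : Prop :=
  forall (i : int) (x : tate M i), scomp f x = 0.

Definition generating_hypothesis : Prop :=
  forall (M N : fdmod) (f : shom M N), ghost f -> f = 0.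

Definition tate_full : Prop :=
  forall (M N : fdmod) (phi : graded_hom M N),
    exists f : shom M N, forall i (x : tate M i), phi i x = scomp f x.

End Tate.
End StableCategory.

(* Main.v *)
(* Tate duality: with theta_a a k-linear endomorphism of the cover of Omega^a k
   whose norm (sum of conjugates) is the identity,
   z |-> tr (prj_a theta_a inc_a z) is a functional t_a on
   Hom(Omega^a k, Omega^(a+1) k), and composition followed by t_a is a perfect
   pairing of Hom(M, Omega^(a+1) k) with Hom(Omega^a k, M), because a map is
   stably trivial iff it is a norm (Higman).  Moreover
   t_b (Omega y . z) = t_a (z . y).

   Let phi : H(M) -> H(N) be a graded homomorphism.  Call beta : N -> J and
   m : M -> J compatible if m x = beta (phi x) for all x.  The composite of m
   with the cone of beta is then a ghost, so the generating hypothesis gives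
   f : M -> N with beta f = m.  Compatible pairs are closed under products and
   Hom(M, N) has finite dimension, so one f solves all compatible pairs.  By
   duality every beta : N -> Omega^(a+1) k belongs to a compatible pair, and
   these beta detect H^a(N); hence f induces phi. *)
From HB Require Import structures.
From mathcomp Require Import all_boot all_order all_fingroup all_algebra.
From mathcomp Require Import all_solvable generic_quotient boolp.
Require Import Defs.

Set Implicit Arguments.
Unset Strict Implicit.
Unset Printing Implicit Defensive.

Import GRing.Theory.
Local Open Scope ring_scope.
Local Open Scope quotient_scope.

(** * Subspaces of matrix spaces and their functionals, written as traces *)

Section LinearAlgebra.
Variable k : fieldType.

Definition subspace (V : lmodType k) (S : V -> Prop) : Prop :=
  S 0 /\ forall c u v, S u -> S v -> S (c *: u + v).

(** Take [A] of maximal rank among matrices whose row space lies in [S]; adjoining a vector of [S]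
    cannot raise the rank, so that vector is already in the row space. *)
Lemma subspace_mx n (S : 'rV[k]_n -> Prop) :
  subspace S -> exists A : 'M[k]_n, forall v, S v <-> (v <= A)%MS.
Proof.
move=> [S0 SD].
pose P d := `[< exists A : 'M[k]_n, (forall v, (v <= A)%MS -> S v) /\ \rank A = d >].
have exP : exists d, P d.
  exists 0%N; apply/asboolP; exists 0; split=> [v|]; last exact: mxrank0.
  by rewrite submx0 => /eqP ->.
have ubP d : P d -> (d <= n)%N.
  by move=> /asboolP[A [_ <-]]; apply: rank_leq_row.
case: (ex_maxnP exP ubP) => d /asboolP[A [AS rkA]] maxd.
exists A => v; split=> [Sv|]; last exact: AS.
have: P (\rank (A + v)%MS).
  apply/asboolP; exists (A + v)%MS; split=> // w /sub_addsmxP[[a b]] /= ->.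
  rewrite addrC [b]mx11_scalar mul_scalar_mx; apply: SD => //.
  by apply: AS; apply: submxMl.
move=> /maxd; rewrite -rkA => le_rk.
have := (mxrank_leqif_sup (addsmxSl A v)).2.
rewrite eqn_leq le_rk mxrankS ?addsmxSl //= => /esym.
exact: submx_trans (addsmxSr A v).
Qed.

Lemma functional_extend n (S : 'rV[k]_n -> Prop) (l : 'rV[k]_n -> k) :
    subspace S ->
    (forall c u v, S u -> S v -> l (c *: u + v) = c * l u + l v) ->
  exists w : 'cV[k]_n, forall v, S v -> l v = (v *m w) 0 0.
Proof.
move=> Sub lD; have [A AP] := subspace_mx Sub; have [S0 SD] := Sub.
have l0 : l 0 = 0.
  by have := lD (-1) _ _ S0 S0; rewrite scaleN1r oppr0 addr0 mulN1r addNr.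
pose b : 'cV[k]_n := \col_i l (row i A).
exists (pinvmx A *m b) => v /AP vA.
have Srow i : S (row i A) by apply/AP; apply: row_sub.
have lsum (r : seq 'I_n) (c : 'I_n -> k) :
    S (\sum_(i <- r) c i *: row i A) /\
    l (\sum_(i <- r) c i *: row i A) = \sum_(i <- r) c i * l (row i A).
  elim: r => [|i r [IHS IHl]]; first by rewrite !big_nil.
  by rewrite !big_cons; split; [apply: SD | rewrite lD ?IHl].
rewrite mulmxA -{1}(mulmxKpV vA) mulmx_sum_row (lsum _ _).2 mxE.
by apply: eq_bigr => i _; rewrite [b _ _]mxE.
Qed.

Lemma trace_pairing m n (w : 'cV[k]_(m * n)) :
  exists u : 'M[k]_(n, m), forall F : 'M_(m, n),
    (mxvec F *m w) 0 0 = \tr (F *m u).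
Proof.
exists (\matrix_(j, i) w (mxvec_index i j) 0) => F.
rewrite mxE (reindex _ (curry_mxvec_bij _ _)) /= /mxtrace.
under [RHS]eq_bigr => i _ do rewrite mxE.
rewrite pair_bigA; apply: eq_bigr => -[i j] _.
by rewrite /= mxvecE [(\matrix_(_, _) _) _ _]mxE.
Qed.

Lemma subspace_vec m n (S : 'M[k]_(m, n) -> Prop) :
  subspace S -> subspace (S \o vec_mx).
Proof.
move=> [S0 SD]; split=> [|c u v] /=; first by rewrite linear0.
by move=> Su Sv; rewrite linearP; apply: SD.
Qed.

Lemma mx_functional_trace m n (S : 'M[k]_(m, n) -> Prop) (l : 'M[k]_(m, n) -> k) :
    subspace S ->
    (forall c u v, S u -> S v -> l (c *: u + v) = c * l u + l v) ->
  exists u : 'M[k]_(n, m), forall F, S F -> l F = \tr (F *m u).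
Proof.
move=> Ssub lD.
have [|w wP] := @functional_extend _ _ (l \o vec_mx) (subspace_vec Ssub).
  by move=> c u v /= Su Sv; rewrite linearP lD.
have [u uP] := trace_pairing w; exists u => F SF.
by rewrite -uP -wP /= mxvecK.
Qed.

(** Some column of the cokernel matrix of the subspace is nonzero on [F0]; it vanishes on all of
    [S], and [trace_pairing] rewrites it as a trace. *)
Lemma mx_separation m n (S : 'M[k]_(m, n) -> Prop) (F0 : 'M[k]_(m, n)) :
    subspace S -> ~ S F0 ->
  exists2 u : 'M[k]_(n, m), \tr (F0 *m u) != 0 &
    forall F, S F -> \tr (F *m u) = 0.
Proof.
move=> Ssub SF0; have [A AP] := subspace_mx (subspace_vec Ssub).
have AE F : S F <-> (mxvec F <= A)%MS by rewrite -AP /= mxvecK.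
have /rV0Pn[j nz] : mxvec F0 *m cokermx A != 0.
  by rewrite -submxE; apply/negP => /AE.
have [u uP] := trace_pairing (col j (cokermx A)).
have colE F : (mxvec F *m col j (cokermx A)) 0 0 = (mxvec F *m cokermx A) 0 j.
  by rewrite colE mulmxA -colE mxE.
exists u => [|F /AE]; first by rewrite -uP colE.
by rewrite -uP colE submxE => /eqP ->; rewrite mxE.
Qed.

Lemma eq_mulmx_row m n (A B : 'M[k]_(m, n)) :
  (forall u : 'rV_m, u *m A = u *m B) -> A = B.
Proof. by move=> AB; apply/row_matrixP => i; rewrite !rowE AB. Qed.

End LinearAlgebra.

(** Lets a function built inside a proof, often by choice, be used as a bundled linear map. *)
Lemma linear_pack (R : nzRingType) (M N : lmodType R) (f : M -> N) :
  linear f -> exists h : {linear M -> N}, h =1 f.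
Proof.
move=> lf; pose H := GRing.isLinear.Build R M N *:%R f lf.
by exists (HB.pack f H : {linear M -> N}).
Qed.

(** * Group elements inside kG, and k-bases of finite-dimensional modules *)

Section GroupElements.
Variables (k : fieldType) (G : finGroupType).
Notation kG := (grpalg k G).

Definition gelt (g : G) : kG := [ffun h => (h == g)%:R].

Lemma grpalg_scalerE (c : k) (a : kG) g : (c *: a) g = c * a g.
Proof. by rewrite ffunE. Qed.

Lemma gelt1 : gelt 1%g = 1.
Proof. by apply/ffunP => h; rewrite !ffunE. Qed.

Lemma geltM g h : gelt (g * h)%g = gelt g * gelt h.
Proof.
apply/ffunP => x; rewrite !ffunE (bigD1 g) //= big1 => [|y yg].
  by rewrite !ffunE eqxx mul1r addr0 -(inj_eq (mulgI g^-1%g)) mulKg.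
by rewrite ffunE (negPf yg) mul0r.
Qed.

Lemma grpalgE (a : kG) : a = \sum_(g : G) (a g : k)%:A * gelt g.
Proof.
apply/ffunP => x; rewrite sum_ffunE (bigD1 x) //= big1 => [|y yx].
  by rewrite mulr_algl grpalg_scalerE ffunE eqxx mulr1 addr0.
by rewrite mulr_algl grpalg_scalerE ffunE eq_sym (negPf yx) mulr0.
Qed.

Lemma scal_central (c : k) (a : kG) : c%:A * a = a * c%:A.
Proof.
rewrite mulr_algl; apply/ffunP => x; rewrite grpalg_scalerE ffunE.
rewrite (bigD1 x) //= big1 => [|y yx].
  by rewrite grpalg_scalerE ffunE mulVg eqxx mulr1 addr0 mulrC.
by rewrite grpalg_scalerE ffunE -eq_mulVg1 (negPf yx) !mulr0.
Qed.

Lemma scaler_scalC (M : lmodType kG) (c : k) (a : kG) (x : M) :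
  a *: (c%:A *: x) = c%:A *: (a *: x).
Proof. by rewrite !scalerA scal_central. Qed.

(** Linearity over the ground field only: norms are formed from such maps, and the action of a
    single group element is one. *)
Definition klinear (M N : lmodType kG) (f : M -> N) : Prop :=
  forall (c : k) x y, f (c%:A *: x + y) = c%:A *: f x + f y.

Lemma klinear_linear (M N : lmodType kG) (f : M -> N) :
  klinear f -> (forall g x, f (gelt g *: x) = gelt g *: f x) -> linear f.
Proof.
move=> fk fg.
have fD x y : f (x + y) = f x + f y by have := fk 1 x y; rewrite !scale1r.
have f0 : f 0 = 0 by apply: (addIr (f 0)); rewrite -fD !add0r.
have fZ c x : f (c%:A *: x) = c%:A *: f x.
  by have := fk c x 0; rewrite f0 !addr0.
move=> a x y; rewrite fD; congr (_ + _).
rewrite {1 2}[a]grpalgE !scaler_suml (big_morph f fD f0).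
by apply: eq_bigr => g _; rewrite -!scalerA fZ fg.
Qed.

Record frame (M : lmodType kG) : Type := Frame {
  vdim : nat;
  vec : 'rV[k]_vdim -> M;
  coord : M -> 'rV[k]_vdim;
  vecD : forall c u v, vec (c *: u + v) = c%:A *: vec u + vec v;
  vecK : cancel vec coord;
  coordK : cancel coord vec
}.

Lemma frame_exists (M : lmodType kG) : findim M -> exists fr : frame M, True.
Proof.
move=> [n [v vspan]].
pose b (u : 'rV[k]_n) : M := \sum_i (u 0 i)%:A *: v i.
have bD c u w : b (c *: u + w) = c%:A *: b u + b w.
  rewrite /b scaler_sumr -big_split; apply: eq_bigr => i _.
  by rewrite !mxE scalerA mulr_algl scalerDl scalerDl scalerA.
have b0 : b 0 = 0.
  by rewrite /b big1 // => i _; rewrite mxE scale0r scale0r.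
have bsurj x : exists u, b u = x.
  have [c ->] := vspan x; exists (\row_i c i).
  by apply: eq_bigr => i _; rewrite mxE.
have [|K KP] := @subspace_mx k n (fun u => b u = 0).
  by split=> // c u w u0 w0; rewrite bD u0 w0 scaler0 addr0.
(* The spanning family gives a surjection [b] with kernel [K]; restricted to a basis of a complement
   of [K] it becomes bijective. *)
pose B := row_base (K^C)%MS.
have bBD c u w : b ((c *: u + w) *m B) = c%:A *: b (u *m B) + b (w *m B).
  by rewrite mulmxDl -scalemxAl bD.
have bBinj : injective (fun u => b (u *m B)).
  move=> u w /= buw; apply/eqP; rewrite -subr_eq0; apply/eqP.
  have /KP sK : b ((u - w) *m B) = 0.
    by rewrite -scaleN1r addrC bBD buw scaleN1r scaleN1r addNr.
  have sC : ((u - w) *m B <= K^C)%MS.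
    by rewrite (submx_trans (submxMl _ _)) // eq_row_base.
  have : ((u - w) *m B <= K :&: K^C)%MS by rewrite sub_capmx sK sC.
  rewrite capmx_compl submx0 => /eqP uwB.
  by apply: (row_free_inj (row_base_free (K^C)%MS)); rewrite uwB mul0mx.
have bBsurj x : exists u, b (u *m B) = x.
  have [w <-] := bsurj x.
  have /sub_addsmxP[[w1 w2] /= wE] : (w <= K + K^C)%MS.
    exact/submx_full/addsmx_compl_full.
  have /submxP[u uE] : (w2 *m K^C%MS <= B)%MS.
    by rewrite eq_row_base submxMl.
  exists u; rewrite -uE wE -[w1 *m K]scale1r bD.
  have /KP -> : (w1 *m K <= K)%MS by apply: submxMl.
  by rewrite scaler0 add0r.
have [r rP] := choice bBsurj.
have vK : cancel (fun u => b (u *m B)) r.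
  by move=> u; apply: bBinj; rewrite /= rP.
by exists (@Frame M _ (fun u => b (u *m B)) r bBD vK rP).
Qed.

End GroupElements.

(** * Modules as matrix representations, norms, and Higman's criterion *)

Section Matrices.
Variables (k : fieldType) (G : finGroupType).
Notation kG := (grpalg k G).
Notation fdmod := (fdmod k G).

Definition fr (M : fdmod) : frame M := sval (cid (frame_exists (fd_findim M))).
Definition dimv (M : fdmod) : nat := vdim (fr M).
Definition bv (M : fdmod) : 'rV[k]_(dimv M) -> M := @vec _ _ _ (fr M).
Definition co (M : fdmod) : M -> 'rV[k]_(dimv M) := @coord _ _ _ (fr M).

Lemma bvK M : cancel (@bv M) (@co M). Proof. exact: vecK. Qed.
Lemma coK M : cancel (@co M) (@bv M). Proof. exact: coordK. Qed.

Lemma bvP (M : fdmod) c u v :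
  bv (c *: u + v) = c%:A *: bv u + bv v :> M.
Proof. exact: vecD. Qed.

Lemma coP (M : fdmod) (c : k) (x y : M) : co (c%:A *: x + y) = c *: co x + co y.
Proof. by apply: (can_inj (@bvK M)); rewrite bvP !coK. Qed.

Lemma coD (M : fdmod) (x y : M) : co (x + y) = co x + co y.
Proof. by have := coP 1 x y; rewrite !scale1r. Qed.

Definition mxh (M N : fdmod) (f : M -> N) : 'M[k]_(dimv M, dimv N) :=
  lin1_mx (@co N \o f \o @bv M).

Lemma mxhE (M N : fdmod) (f : M -> N) x :
  klinear f -> co (f x) = co x *m mxh f.
Proof.
move=> fk.
have [h hE] : exists h : {linear 'rV[k]_(dimv M) -> 'rV[k]_(dimv N)},
    h =1 @co N \o f \o @bv M.
  by apply: linear_pack => c u v /=; rewrite bvP fk coP.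
by rewrite /mxh -(funext hE) mul_rV_lin1 hE /= coK.
Qed.

Lemma mxh_unique (M N : fdmod) (f : M -> N) F :
  (forall x, co (f x) = co x *m F) -> mxh f = F.
Proof.
move=> fF; apply: eq_mulmx_row => u.
have fk : klinear f.
  by move=> c x y; apply: (can_inj (@coK N)); rewrite fF !coP !fF mulmxDl scalemxAl.
by rewrite -[u]bvK -mxhE.
Qed.

Lemma linear_klinear (M N : fdmod) (f : {linear M -> N}) : klinear f.
Proof. by move=> c x y; rewrite linearP. Qed.
#[local] Hint Resolve linear_klinear : core.

Lemma klinear_gelt (M : fdmod) g : klinear (fun x : M => gelt k g *: x).
Proof. by move=> c x y; rewrite scalerDr scaler_scalC. Qed.

Definition act (M : fdmod) (g : G) : 'M[k]_(dimv M) :=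
  mxh (fun x : M => gelt k g *: x).

Lemma actE (M : fdmod) g (x : M) : co (gelt k g *: x) = co x *m act M g.
Proof. exact: mxhE (klinear_gelt _). Qed.

Lemma act1 M : act M 1%g = 1%:M.
Proof. by apply: mxh_unique => x; rewrite gelt1 scale1r mulmx1. Qed.

(* Row vectors are acted on from the right, so [act] reverses products. *)
Lemma actM M g h : act M (g * h)%g = act M h *m act M g.
Proof. by apply: mxh_unique => x; rewrite geltM -scalerA !actE mulmxA. Qed.

(** These are exactly the matrices of kG-linear maps, by [mxh_intertw] and [intertw_mxh]. *)
Definition intertw (M N : fdmod) (F : 'M[k]_(dimv M, dimv N)) : Prop :=
  forall g, act M g *m F = F *m act N g.

Lemma mxh_intertw (M N : fdmod) (f : {linear M -> N}) : intertw (mxh f).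
Proof.
move=> g; apply: eq_mulmx_row => u; rewrite !mulmxA -[u]bvK -actE.
by rewrite -!(mxhE _ (@linear_klinear _ _ f)) -actE linearZ.
Qed.

Lemma intertw_mxh (M N : fdmod) (F : 'M[k]_(dimv M, dimv N)) :
  intertw F -> exists f : {linear M -> N}, mxh f = F.
Proof.
move=> Fg; pose f x : N := bv (co x *m F).
have fE x : co (f x) = co x *m F by rewrite bvK.
have [|h hf] := @linear_pack _ _ _ f.
  apply: klinear_linear => [c x y|g x]; apply: (can_inj (@coK N)).
    by rewrite fE !coP !fE mulmxDl scalemxAl.
  by rewrite actE !fE actE -!mulmxA Fg.
by exists h; apply: mxh_unique => x; rewrite hf.
Qed.

Lemma mxh_inj (M N : fdmod) (f g : {linear M -> N}) : mxh f = mxh g -> f =1 g.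
Proof. by move=> fg x; apply: (can_inj (@coK N)); rewrite !mxhE ?fg. Qed.

Lemma mxh_comp (L M N : fdmod) (g : M -> N) (f : L -> M) :
  klinear g -> klinear f -> mxh (g \o f) = mxh f *m mxh g.
Proof.
by move=> gk fk; apply: mxh_unique => x /=; rewrite !mxhE // mulmxA.
Qed.

Lemma mxh_add (M N : fdmod) (f g : hom M N) : mxh (f + g) = mxh f + mxh g.
Proof.
by apply: mxh_unique => x; rewrite /= coD !mxhE // mulmxDr.
Qed.

(** The transfer from the trivial subgroup: the sum of the conjugates of a k-linear map. *)
Definition norm (M N : fdmod) (F : 'M[k]_(dimv M, dimv N)) :=
  \sum_(g : G) act M g^-1%g *m F *m act N g.

Lemma norm_intertw M N F : intertw (@norm M N F).
Proof.
move=> h; rewrite /norm mulmx_sumr mulmx_suml (reindex_inj (mulgI h)) /=.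
apply: eq_bigr => g _.
by rewrite actM !mulmxA -actM invMg mulgKV.
Qed.

Lemma norm_mull (L M N : fdmod) (E : 'M_(dimv L, dimv M)) (F : 'M_(dimv M, dimv N)) :
  intertw E -> @norm L N (E *m F) = E *m @norm M N F.
Proof.
move=> Eg; rewrite /norm mulmx_sumr; apply: eq_bigr => g _.
by rewrite !mulmxA Eg.
Qed.

Lemma norm_mulr (L M N : fdmod) (F : 'M_(dimv L, dimv M)) (E : 'M_(dimv M, dimv N)) :
  intertw E -> @norm L N (F *m E) = @norm L M F *m E.
Proof.
move=> Eg; rewrite /norm mulmx_suml; apply: eq_bigr => g _.
by rewrite -!mulmxA Eg.
Qed.

Lemma norm_is_linear (M N : fdmod) c (E F : 'M_(dimv M, dimv N)) :
  @norm M N (c *: E + F) = c *: @norm M N E + @norm M N F.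
Proof.
rewrite /norm scaler_sumr -big_split; apply: eq_bigr => g _ /=.
by rewrite mulmxDr mulmxDl -scalemxAr -scalemxAl.
Qed.

(** Cyclicity of the trace moves the conjugating matrices to the other factor, with [g] replaced by
    its inverse; thus the norm is self-adjoint. *)
Lemma norm_trace (M N : fdmod) (E : 'M_(dimv M, dimv N)) (F : 'M_(dimv N, dimv M)) :
  \tr (@norm M N E *m F) = \tr (E *m @norm N M F).
Proof.
rewrite /norm mulmx_suml mulmx_sumr !linear_sum (reindex_inj invg_inj) /=.
apply: eq_bigr => g _; rewrite invgK.
by rewrite -!mulmxA mxtrace_mulC !mulmxA.
Qed.

Section FreeModules.
Variable n : nat.
Let F : lmodType kG := 'rV[kG]_n.

Lemma row_module_sum (w : F) : w = \sum_i w 0 i *: delta_mx 0 i.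
Proof. exact: row_sum_delta. Qed.

Lemma projective_free : projective F.
Proof.
move=> A B e h esurj.
have [a aP] := choice (fun i => esurj (h (delta_mx 0 i))).
have [|l lE] := @linear_pack _ F A (fun w : F => \sum_i w 0 i *: a i).
  move=> c u v; rewrite scaler_sumr -big_split; apply: eq_bigr => i _ /=.
  by rewrite !mxE scalerDl scalerA.
exists l => w /=; rewrite lE [in RHS](row_module_sum w) !linear_sum.
by apply: eq_bigr => i _; rewrite !linearZ /= aP.
Qed.

Lemma findim_free : findim F.
Proof.
pose I := ('I_n * G)%type.
exists #|{: I}|, (fun j => let: (i, g) := enum_val j : I in
  gelt k g *: delta_mx 0 i) => w.
exists (fun j => let: (i, g) := enum_val j : I in w 0 i g).
rewrite [LHS]row_module_sum.
pose t (ig : I) : F :=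
  (w 0 ig.1 ig.2 : k)%:A *: (gelt k ig.2 *: delta_mx 0 ig.1).
transitivity (\sum_(ig : I) t ig).
  rewrite -(pair_bigA _ (fun i g => t (i, g))) /=; apply: eq_bigr => i _.
  rewrite [w 0 i]grpalgE scaler_suml; apply: eq_bigr => g _.
  by rewrite /t /= -scalerA.
rewrite (reindex_onto enum_val enum_rank) => [|ig _]; last exact: enum_rankK.
rewrite (eq_bigl xpredT) => [|j]; last by rewrite enum_valK eqxx.
by apply: eq_bigr => j _; rewrite /t; case: (enum_val j).
Qed.

Definition free_mod : fdmod := FdMod findim_free.

End FreeModules.

Lemma co0 (M : fdmod) : co (0 : M) = 0.
Proof. by apply: (addIr (co (0 : M))); rewrite -coD !add0r. Qed.

Lemma coZ (M : fdmod) (c : k) (x : M) : co (c%:A *: x) = c *: co x.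
Proof. by have := coP c x 0; rewrite co0 !addr0. Qed.

Lemma co_sum (M : fdmod) (I : Type) (r : seq I) (P : pred I) (F : I -> M) :
  co (\sum_(i <- r | P i) F i) = \sum_(i <- r | P i) co (F i).
Proof. exact: (big_morph (@co M) (@coD M) (co0 M)). Qed.

Lemma gelt_mulE g (a : kG) h : (gelt k g * a) h = a (g^-1 * h)%g.
Proof.
rewrite ffunE (bigD1 g) //= big1 => [|x xg].
  by rewrite ffunE eqxx mul1r addr0.
by rewrite ffunE (negPf xg) mul0r.
Qed.

Lemma normP (M N : fdmod) (f : M -> N) (x : M) : klinear f ->
  co x *m norm (mxh f) = co (\sum_(g : G) gelt k g *: f (gelt k g^-1 *: x)).
Proof.
move=> fk; rewrite co_sum /norm mulmx_sumr; apply: eq_bigr => g _.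
by rewrite actE mxhE // actE !mulmxA.
Qed.

Lemma free_lift n (N : lmodType kG) (b : 'I_n -> N) :
  exists e : {linear free_mod n -> N}, forall w, e w = \sum_i (w : 'rV_n) 0 i *: b i.
Proof.
apply: (@linear_pack _ (free_mod n) N (fun w => \sum_i (w : 'rV_n) 0 i *: b i)).
move=> c u v; rewrite scaler_sumr -big_split; apply: eq_bigr => i _ /=.
by rewrite !mxE scalerDl scalerA.
Qed.

(* [free_mod (dimv M)] serves as the coinduced module of the vector space
   underlying M. *)
Lemma free_embedding (M : fdmod) :
  exists i : {linear M -> free_mod (dimv M)},
    forall x j g, (i x : 'rV_(dimv M)) 0 j g = co (gelt k g^-1%g *: x) 0 j.
Proof.
pose i x : free_mod (dimv M) :=
  \row_j ([ffun g => co (gelt k g^-1%g *: x) 0 j] : kG).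
have iE x j g : (i x : 'rV_(dimv M)) 0 j g = co (gelt k g^-1%g *: x) 0 j.
  by rewrite mxE ffunE.
have [|h hE] := @linear_pack _ M (free_mod (dimv M)) i; last first.
  by exists h => x j g; rewrite hE.
apply: klinear_linear => [c x y|h x]; apply/rowP => j; apply/ffunP => g.
  by rewrite iE scalerDr scaler_scalC coP !mxE mulr_algl !ffunE.
by rewrite iE [in RHS]mxE gelt_mulE -/(i x) iE scalerA -geltM invMg invgK.
Qed.

(** The coefficients at the identity of [G] are the coordinates of the vector. *)
Lemma free_embedding_inj (M : fdmod) (i : {linear M -> free_mod (dimv M)}) :
  (forall x j g, (i x : 'rV_(dimv M)) 0 j g = co (gelt k g^-1%g *: x) 0 j) ->
  injective i.
Proof.
move=> iE x y ixy; apply: (can_inj (@coK M)); apply/rowP => j.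
by have := iE x j 1%g; rewrite ixy iE invg1 gelt1 !scale1r.
Qed.

Lemma bv_delta_sum (M : fdmod) (u : 'rV[k]_(dimv M)) :
  bv u = \sum_i (u 0 i)%:A *: bv (delta_mx 0 i) :> M.
Proof.
apply: (can_inj (@coK M)); rewrite bvK co_sum [LHS]row_sum_delta.
by apply: eq_bigr => i _; rewrite coZ bvK.
Qed.

Lemma projective_norm (P : fdmod) :
  projective P -> exists T : 'M_(dimv P), @norm P P T = 1%:M.
Proof.
move=> Pproj; pose b j : P := bv (delta_mx 0 j).
have [e eE] := free_lift b.
have [y|l lP] := Pproj _ _ e idfun.
  exists (\row_j ((co y 0 j)%:A : kG)); rewrite eE -[RHS]coK bv_delta_sum.
  by apply: eq_bigr => j _; rewrite mxE.
(* [f] keeps only the identity coefficients of the splitting [l]. Conjugating by [g] picks out the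
   coefficients at [g], so the conjugates of [f] sum to [e \o l], the identity. *)
pose f x : P := \sum_j ((l x : 'rV_(dimv P)) 0 j 1%g : k)%:A *: b j.
have fk : klinear f.
  move=> c x y; rewrite /f scaler_sumr -big_split; apply: eq_bigr => j _ /=.
  rewrite linearP mxE mxE mulr_algl !ffunE scalerDl scalerDl scalerA.
  by congr (_ + _); rewrite mulr_algl scalerA.
exists (mxh f); apply: eq_mulmx_row => u; rewrite -[u](@bvK P) normP // mulmx1.
congr co; rewrite -[RHS]lP /= eE /f.
under eq_bigr => g _ do rewrite scaler_sumr.
rewrite exchange_big; apply: eq_bigr => j _.
rewrite [in RHS](grpalgE (_ 0 j)) scaler_suml; apply: eq_bigr => g _.
by rewrite scaler_scalC -scalerA linearZ mxE gelt_mulE invgK mulg1.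
Qed.

(** One half of Higman's criterion. The embedding records the coordinates of all translates of [x];
    sending the j-th free generator to the image of the j-th basis vector under [F] then sums the
    conjugates of [F]. *)
Lemma norm_factors (M N : fdmod) (f : {linear M -> N}) (F : 'M_(dimv M, dimv N)) :
  mxh f = @norm M N F -> factors_through_projective (f : Defs.hom M N).
Proof.
move=> fF; exists (free_mod (dimv M)); split; first exact: projective_free.
have [i iE] := free_embedding M.
have [e eE] := free_lift (fun j => bv (row j F) : N).
exists i, e => x; apply: (can_inj (@coK N)); rewrite mxhE // fF.
rewrite /= eE co_sum /norm mulmx_sumr.
transitivity (\sum_(g : G) \sum_j co (gelt k g^-1 *: x) 0 j *: (row j F *m act N g)).
  apply: eq_bigr => g _; rewrite !mulmxA -actE [X in X *m _]mulmx_sum_row mulmx_suml.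
  by apply: eq_bigr => j _; rewrite scalemxAl.
rewrite exchange_big; apply: eq_bigr => j _.
rewrite (grpalgE (_ 0 j)) scaler_suml co_sum; apply: eq_bigr => g _.
by rewrite -scalerA coZ !actE bvK iE actE.
Qed.

(** The other half: the identity of the projective module is a norm, and kG-linear maps can be moved
    inside a norm. *)
Lemma factors_norm (M N : fdmod) (f : Defs.hom M N) :
  factors_through_projective f -> exists F : 'M_(dimv M, dimv N), mxh f = @norm M N F.
Proof.
move=> [P [/projective_norm[T T1] [a [b fab]]]].
exists (mxh a *m (T *m mxh b)).
rewrite norm_mull ?norm_mulr ?T1 ?mul1mx; try exact: mxh_intertw.
by rewrite (funext fab : (f : M -> N) = b \o a) mxh_comp.
Qed.

End Matrices.

(** * The cokernel of a linear map as a module *)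

Section Cokernel.
Variables (R : nzRingType) (N E : lmodType R) (f : {linear N -> E}).

Definition in_range : {pred E} := fun y => `[< exists x, f x = y >].

Fact in_range_zmod_closed : zmod_closed in_range.
Proof.
split=> [|x y /asboolP[a <-] /asboolP[b <-]]; apply/asboolP.
  by exists 0; rewrite raddf0.
by exists (a - b); rewrite raddfB.
Qed.

HB.instance Definition _ := GRing.isZmodClosed.Build E in_range in_range_zmod_closed.

Definition coker : Type := Quotient.quot in_range.

HB.instance Definition _ := GRing.Zmodule.on coker.

Definition coker_proj (x : E) : coker := \pi_(Quotient.quot in_range) x.

Lemma coker_proj_eq x y :
  coker_proj x = coker_proj y <-> exists a, f a = x - y.
Proof.
split=> [/eqP|xy]; first by rewrite -Quotient.idealrBE => /asboolP.
by apply/eqP; rewrite -Quotient.idealrBE; apply/asboolP.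
Qed.

Lemma coker_proj_surj (q : coker) : exists x, coker_proj x = q.
Proof. by exists (repr q); apply: reprK. Qed.

Lemma coker_projD x y : coker_proj (x + y) = coker_proj x + coker_proj y.
Proof. exact: raddfD. Qed.

Definition coker_scale (a : R) (q : coker) : coker :=
  coker_proj (a *: (repr (q : Quotient.quot in_range) : E)).

Lemma coker_scale_proj a x : coker_scale a (coker_proj x) = coker_proj (a *: x).
Proof.
apply/coker_proj_eq.
have /coker_proj_eq[b bE] : coker_proj (repr (coker_proj x)) = coker_proj x.
  exact: reprK.
by exists (a *: b); rewrite linearZ /= bE scalerBr.
Qed.

Fact coker_scaleA a b q : coker_scale a (coker_scale b q) = coker_scale (a * b) q.
Proof. by have [x <-] := coker_proj_surj q; rewrite !coker_scale_proj scalerA. Qed.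

Fact coker_scale1 : left_id 1 coker_scale.
Proof.
by move=> q; have [x <-] := coker_proj_surj q; rewrite coker_scale_proj scale1r.
Qed.

Fact coker_scaleDr : right_distributive coker_scale +%R.
Proof.
move=> a q r; have [x <-] := coker_proj_surj q; have [y <-] := coker_proj_surj r.
by rewrite -coker_projD !coker_scale_proj scalerDr coker_projD.
Qed.

Fact coker_scaleDl q : {morph coker_scale^~ q : a b / a + b}.
Proof.
move=> a b; have [x <-] := coker_proj_surj q.
by rewrite !coker_scale_proj scalerDl coker_projD.
Qed.

HB.instance Definition _ := GRing.Zmodule_isLmodule.Build R coker
  coker_scaleA coker_scale1 coker_scaleDr coker_scaleDl.

Fact coker_proj_linear : linear coker_proj.
Proof.
by move=> a x y; rewrite coker_projD -coker_scale_proj.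
Qed.

HB.instance Definition _ :=
  GRing.isLinear.Build R E coker *:%R coker_proj coker_proj_linear.

End Cokernel.

(** * Composition in the stable category, and weak cokernels *)

Section StableCategoryTheory.
Variables (k : fieldType) (G : finGroupType).
Notation kG := (grpalg k G).
Notation fdmod := (fdmod k G).
Notation hom := Defs.hom.

Lemma stable_surj (M N : fdmod) (x : shom M N) : exists f : hom M N, x = stable f.
Proof. by exists (repr x); rewrite /stable reprK. Qed.

Lemma stableD (M N : fdmod) (f g : hom M N) :
  stable (f + g : hom M N) = stable f + stable g.
Proof. exact: raddfD. Qed.

Lemma stableN (M N : fdmod) (f : hom M N) : stable (- f : hom M N) = - stable f.
Proof. exact: raddfN. Qed.

Lemma stable0 (M N : fdmod) : stable (0 : hom M N) = 0.
Proof. exact: raddf0. Qed.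

Lemma stable_eq0 (M N : fdmod) (f : hom M N) :
  stable f = 0 <-> factors_through_projective f.
Proof.
by rewrite -stable0 stableE subr0.
Qed.

Lemma stable_ext (M N : fdmod) (f g : hom M N) :
  (f : M -> N) =1 g -> stable f = stable g.
Proof. by move=> /hom_ext ->. Qed.

Lemma scompA (K L M N : fdmod) (z : shom M N) (y : shom L M) (x : shom K L) :
  scomp z (scomp y x) = scomp (scomp z y) x.
Proof.
have [f ->] := stable_surj x; have [g ->] := stable_surj y.
by have [h ->] := stable_surj z; rewrite !scompE; apply: stable_ext.
Qed.

Lemma scompDl (L M N : fdmod) (y z : shom M N) (x : shom L M) :
  scomp (y + z) x = scomp y x + scomp z x.
Proof.
have [f ->] := stable_surj x; have [g ->] := stable_surj y.
have [h ->] := stable_surj z; rewrite -stableD !scompE -stableD.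
exact: stable_ext.
Qed.

Lemma scompDr (L M N : fdmod) (z : shom M N) (x y : shom L M) :
  scomp z (x + y) = scomp z x + scomp z y.
Proof.
have [f ->] := stable_surj x; have [g ->] := stable_surj y.
have [h ->] := stable_surj z; rewrite -stableD !scompE -stableD.
by apply: stable_ext => u /=; rewrite raddfD.
Qed.

Lemma scomp0x (L M N : fdmod) (x : shom L M) : scomp (0 : shom M N) x = 0.
Proof. by apply: (addIr (scomp 0 x)); rewrite -scompDl !add0r. Qed.

Lemma scompx0 (L M N : fdmod) (z : shom M N) : scomp z (0 : shom L M) = 0.
Proof. by apply: (addIr (scomp z 0)); rewrite -scompDr !add0r. Qed.

Lemma scompNl (L M N : fdmod) (z : shom M N) (x : shom L M) :
  scomp (- z) x = - scomp z x.
Proof. by apply: (addIr (scomp z x)); rewrite -scompDl !addNr scomp0x. Qed.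

Lemma scompNr (L M N : fdmod) (z : shom M N) (x : shom L M) :
  scomp z (- x) = - scomp z x.
Proof. by apply: (addIr (scomp z x)); rewrite -scompDr !addNr scompx0. Qed.

Lemma scomp1x (M N : fdmod) (n : shom M N) :
  scomp (stable (idfun : {linear N -> N})) n = n.
Proof. by have [r ->] := stable_surj n; rewrite scompE; apply: stable_ext. Qed.

Lemma scompx1 (M N : fdmod) (n : shom M N) :
  scomp n (stable (idfun : {linear M -> M})) = n.
Proof. by have [r ->] := stable_surj n; rewrite scompE; apply: stable_ext. Qed.

Lemma stable_eq0_norm (M N : fdmod) (f : hom M N) :
  stable f = 0 <-> exists F : 'M_(dimv M, dimv N), mxh f = @norm k G M N F.
Proof.
rewrite stable_eq0; split; first exact: factors_norm.
by move=> [F]; apply: norm_factors.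
Qed.

Lemma findim_surj (M N : lmodType kG) (f : {linear M -> N}) :
  (forall y, exists x, f x = y) -> findim M -> findim N.
Proof.
move=> fsurj [n [v vP]]; exists n, (f \o v) => y; have [x <-] := fsurj y.
have [c ->] := vP x; exists c; rewrite linear_sum.
by apply: eq_bigr => i _; rewrite linearZ.
Qed.

(* C is the pushout of beta along an embedding of N into a projective module. *)
Lemma weak_cokernel (N J : fdmod) (beta : shom N J) :
  exists (C : fdmod) (c : shom J C), scomp c beta = 0 /\
    forall (M : fdmod) (m : shom M J), scomp c m = 0 ->
      exists f : shom M N, scomp beta f = m.
Proof.
have [b ->] := stable_surj beta.
have [i /free_embedding_inj i_inj] := free_embedding N.
pose I := free_mod k G (dimv N).
pose E := fdpair J I.
pose nu : {linear N -> E} := (@pair_inl _ J I \o b) \+ (@pair_inr _ J I \o i).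
have nuE x : nu x = (b x, i x) by rewrite /nu /=; congr pair; rewrite ?addr0 ?add0r.
have nu_inj : injective nu by move=> x y; rewrite !nuE => -[_ /i_inj].
have fdC : findim (coker nu : lmodType kG).
  apply: (@findim_surj E _ (@coker_proj _ N E nu)); first exact: coker_proj_surj.
  exact: fd_findim.
pose C := FdMod fdC.
pose p : {linear E -> C} := @coker_proj _ N E nu.
exists C, (stable (p \o @pair_inl _ J I)); split.
  rewrite scompE; apply/stable_eq0.
  exists I; split; first exact: projective_free.
  (* In the pushout the two images of a vector of [N] are opposite, so the composite factors through
     the free module [I]. *)
  exists i, (\- (p \o @pair_inr _ J I)) => x /=.
  rewrite -[RHS](raddfN p); apply/coker_proj_eq; exists x; rewrite nuE.
  by apply: injective_projections; rewrite /= opprK ?addr0 ?add0r.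
move=> M m; have [m0 ->] := stable_surj m; rewrite scompE => /stable_eq0.
move=> [P [Pproj [a [q qa]]]].
(* After lifting [q] to [E], the map [m0] minus the lift dies in the cokernel and so takes values in
   the image of [nu]. *)
have [l lP] := Pproj E C p q (@coker_proj_surj _ N E nu).
have liftP x : exists y, nu y = @pair_inl _ J I (m0 x) - l (a x).
  by apply/coker_proj_eq; apply: (etrans (qa x)); rewrite /= -lP.
have [f fP] := choice liftP.
have [|h hE] := @linear_pack _ M N f.
  move=> c x y; apply: nu_inj; rewrite linearP !fP !linearP /= scalerBr.
  by rewrite scalerN addrACA.
exists (stable h); rewrite scompE; apply/stableE.
exists P; split=> //; exists a, (\- (fst \o l)) => x /=.
have := fP x; rewrite -hE nuE => /(congr1 fst) /= ->.
by rewrite addrAC subrr add0r.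
Qed.

End StableCategoryTheory.

(** * Tate duality for the chosen syzygies, and the functor Omega *)

Section TateDuality.
Variables (k : fieldType) (G : finGroupType).
Notation kG := (grpalg k G).
Notation fdmod := (fdmod k G).
Notation hom := Defs.hom.

Section ShortExact.
Variables (A P B : fdmod) (i : {linear A -> P}) (q : {linear P -> B}).
Hypothesis iq_exact : short_exact i q.

Lemma short_exact_comp0 : mxh i *m mxh q = 0.
Proof.
case: iq_exact => _ iq _; rewrite -mxh_comp; try exact: linear_klinear.
apply: mxh_unique => x /=; have /iq -> : exists a, i a = i x by exists x.
by rewrite co0 mulmx0.
Qed.

Lemma short_exact_inc_free : row_free (mxh i).
Proof.
case: iq_exact => i_inj _ _; apply: inj_row_free => u.
rewrite -[u]bvK -mxhE; last exact: linear_klinear.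
rewrite -(co0 P) => /(can_inj (@coK _ _ P)) i0.
by rewrite -(co0 A); congr co; apply: i_inj; rewrite i0 raddf0.
Qed.

Lemma short_exact_prj_full : row_full (mxh q).
Proof.
case: iq_exact => _ _ qsurj; rewrite -sub1mx; apply/row_subP => j.
have [x qx] := qsurj (bv (row j 1%:M)).
rewrite -[row j _]bvK -qx mxhE; [exact: submxMl | exact: linear_klinear].
Qed.

Lemma short_exact_ker n (V : 'M_(n, dimv P)) : V *m mxh q = 0 -> (V <= mxh i)%MS.
Proof.
case: iq_exact => _ iq _ Vq; apply/row_subP => j.
have /iq[a aE] : q (bv (row j V)) = 0.
  apply: (can_inj (@coK _ _ B)); rewrite mxhE; last exact: linear_klinear.
  by rewrite bvK -row_mul Vq row0 co0.
rewrite -[row j V]bvK -aE mxhE; [exact: submxMl | exact: linear_klinear].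
Qed.

Lemma short_exact_factor (M : fdmod) (V : 'M_(dimv M, dimv P)) :
    @intertw k G M P V -> V *m mxh q = 0 ->
  exists m : {linear M -> A}, mxh m *m mxh i = V.
Proof.
move=> Vg /short_exact_ker Vi.
have [|m mE] := @intertw_mxh k G M A (V *m pinvmx (mxh i)); last first.
  by exists m; rewrite mE mulmxKpV.
move=> g; apply: (row_free_inj short_exact_inc_free).
have VK := mulmxKpV Vi.
by rewrite -[in LHS]mulmxA VK -[in RHS]mulmxA mxh_intertw mulmxA VK Vg.
Qed.

Lemma short_exact_extend (N : fdmod) (V : 'M_(dimv P, dimv N)) :
    @intertw k G P N V -> mxh i *m V = 0 ->
  exists m : {linear B -> N}, mxh q *m mxh m = V.
Proof.
move=> Vg iV; have := mulVpmx short_exact_prj_full.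
move: (pinvmx _) => R q1.
have qV : mxh q *m (R *m V) = V.
  apply/eqP; rewrite -subr_eq0 mulmxA -[X in _ - X]mul1mx -mulmxBl; apply/eqP.
  (* The defect of the k-linear section [R] takes values in the kernel of [q], which is the image of
     [i], where [V] vanishes. *)
  have /short_exact_ker/submxP[K ->] : (mxh q *m R - 1%:M) *m mxh q = 0.
    by rewrite mulmxBl -mulmxA q1 mulmx1 mul1mx subrr.
  by rewrite -mulmxA iV mulmx0.
have [|m mE] := @intertw_mxh k G B N (R *m V); last first.
  by exists m; rewrite mE.
move=> g; rewrite -[LHS]mul1mx -[RHS]mul1mx -q1 -!mulmxA; congr (_ *m _).
by rewrite mulmxA -mxh_intertw -mulmxA qV Vg -[in LHS]qV !mulmxA.
Qed.

End ShortExact.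

Variable W : syzygies k G.

Definition cover_norm a : 'M_(dimv (cover W a)) :=
  sval (cid (projective_norm (@cover_proj k G W a))).

Lemma cover_normP a : norm (cover_norm a) = 1%:M.
Proof. exact: svalP (cid (projective_norm (@cover_proj k G W a))). Qed.

Definition tate_mx a : 'M_(dimv (syz W (a + 1)), dimv (syz W a)) :=
  mxh (syz_inc W a) *m cover_norm a *m mxh (syz_prj W a).

Definition tate_trace a (z : shom (syz W a) (syz W (a + 1))) : k :=
  \tr (mxh (repr z : hom _ _) *m tate_mx a).

Lemma norm_tate_mx a : norm (tate_mx a) = 0.
Proof.
rewrite /tate_mx norm_mulr ?norm_mull ?cover_normP; try exact: mxh_intertw.
by rewrite mulmx1 (short_exact_comp0 (@syz_exact k G W a)).
Qed.

(** Representatives of one class differ by a norm; [norm_trace] moves the norm onto [tate_mx a],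
    where it gives zero. *)
Lemma tate_traceE a (f : hom (syz W a) (syz W (a + 1))) :
  tate_trace (stable f) = \tr (mxh f *m tate_mx a).
Proof.
rewrite /tate_trace; set g := repr _.
have : stable (g - f : hom _ _) = 0.
  by rewrite stableD stableN [stable g]reprK subrr.
move=> /stable_eq0_norm[F FE]; apply/eqP; rewrite -subr_eq0; apply/eqP.
rewrite -linearB /= -mulmxBl.
have -> : mxh g - mxh f = norm F.
  by rewrite -FE; apply: (addIr (mxh f)); rewrite -mxh_add !subrK.
by rewrite norm_trace norm_tate_mx mulmx0 linear0.
Qed.

Lemma tate_traceD a (y z : shom (syz W a) (syz W (a + 1))) :
  tate_trace (y + z) = tate_trace y + tate_trace z.
Proof.
have [f ->] := stable_surj y; have [g ->] := stable_surj z.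
by rewrite -stableD !tate_traceE mxh_add mulmxDl linearD.
Qed.

Lemma mxh0 (M N : fdmod) : mxh (0 : hom M N) = 0.
Proof. by apply: mxh_unique => x; rewrite mulmx0 co0. Qed.

Lemma tate_trace0 a : @tate_trace a 0 = 0.
Proof. by rewrite -stable0 tate_traceE mxh0 mul0mx linear0. Qed.

Lemma tate_traceN a (z : shom (syz W a) (syz W (a + 1))) :
  tate_trace (- z) = - tate_trace z.
Proof. by apply: (addIr (tate_trace z)); rewrite -tate_traceD !addNr tate_trace0. Qed.

Lemma trace_nondeg m n (A : 'M[k]_(m, n)) : (forall F, \tr (F *m A) = 0) -> A = 0.
Proof.
move=> A0; apply: contrapT => nzA.
have [|u nz _] := @mx_separation k m n (fun F => F = 0) A _ nzA.
  by split=> // c u v -> ->; rewrite scaler0 addr0.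
by move: nz; rewrite mxtrace_mulC A0 eqxx.
Qed.

(** Lift [u] k-linearly along the projection to [V]. The norm of [V] projects to the norm of [u],
    which is zero, so it factors through the inclusion; the factor is [m]. Self-adjointness of the
    norm and norm one of [cover_norm a] give the trace formula. *)
Lemma tate_realize a (M : fdmod) (u : 'M_(dimv M, dimv (syz W a))) :
    norm u = 0 ->
  exists m : hom M (syz W (a + 1)), forall x : hom (syz W a) M,
    tate_trace (scomp (stable m) (stable x)) = \tr (mxh x *m u).
Proof.
move=> u0; have ex := @syz_exact k G W a.
pose V := u *m pinvmx (mxh (syz_prj W a)).
have VQ : V *m mxh (syz_prj W a) = u.
  by rewrite /V -mulmxA mulVpmx ?mulmx1 //; apply: short_exact_prj_full ex.
have [||m mE] := @short_exact_factor _ _ _ _ _ ex M (norm V).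
- exact: norm_intertw.
- by rewrite -norm_mulr ?VQ //; apply: mxh_intertw.
exists m => x; rewrite scompE tate_traceE mxh_comp; try exact: linear_klinear.
rewrite /tate_mx -!mulmxA (mulmxA (mxh m)) mE mulmxA -norm_mull; last exact: mxh_intertw.
rewrite norm_trace norm_mulr ?cover_normP ?mul1mx; last exact: mxh_intertw.
by rewrite -mulmxA VQ.
Qed.

(** A nonzero class is not a norm, so some [u] separates it from the norms. Orthogonality to all
    norms means that [u] has norm zero, hence is realized by a map. *)
Lemma tate_detect a (N : fdmod) (x : shom (syz W a) N) :
  x <> 0 -> exists m : shom N (syz W (a + 1)), tate_trace (scomp m x) != 0.
Proof.
have [f ->] := stable_surj x => nz.
have [||u uf u0] := @mx_separation k _ _ (fun F => exists F0, F = norm F0) (mxh f).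
- split=> [|c _ _ [E ->] [F ->]].
    exists 0; have := @norm_is_linear k G (syz W a) N (-1) 0 0.
    by rewrite scaler0 addr0 scaleN1r addNr.
  by exists (c *: E + F); rewrite norm_is_linear.
- by move=> /stable_eq0_norm.
have [|m mE] := @tate_realize a N u.
  by apply: trace_nondeg => F; rewrite -norm_trace u0 //; exists F.
by exists (stable m); rewrite mE.
Qed.

(** [shom] is only an additive group; scalars of [k] act on it by precomposition with these maps,
    which are kG-linear because [c%:A] is central. *)
Definition homothety (M : lmodType kG) (c : k) (x : M) : M := c%:A *: x.

Fact homothety_linear (M : lmodType kG) c : linear (@homothety M c).
Proof. by move=> a x y; rewrite /homothety scalerDr scaler_scalC. Qed.

HB.instance Definition _ (M : lmodType kG) c :=
  GRing.isLinear.Build kG M M *:%R (@homothety M c) (@homothety_linear M c).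

Lemma mxh_homothety (M N : fdmod) c (f : hom M N) :
  mxh (f \o @homothety M c) = c *: mxh f.
Proof.
apply: mxh_unique => x /=; rewrite /homothety linearZ coZ mxhE ?scalemxAr //.
exact: linear_klinear.
Qed.

Lemma tate_represent a (M : fdmod) (l : shom (syz W a) M -> k) :
    {morph l : x y / x + y} ->
    (forall c x, l (scomp x (stable (@homothety (syz W a) c))) = c * l x) ->
  exists m : shom M (syz W (a + 1)), forall x, l x = tate_trace (scomp m x).
Proof.
move=> lD lZ.
pose S F := exists f : hom (syz W a) M, mxh f = F.
have [L LE] : exists L : 'M_(dimv (syz W a), dimv M) -> k,
    forall f : hom (syz W a) M, L (mxh f) = l (stable f).
  (* The value 0 is a default off [S]; on [S] the chosen preimage is unique because [mxh] is
     injective. *)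
  exists (fun F => if pselect (S F) is left e then l (stable (sval (cid e))) else 0).
  move=> f; case: pselect => [e|[]]; last by exists f.
  by congr l; apply/stable_ext/mxh_inj/(svalP (cid e)).
have comb c (f g : hom (syz W a) M) :
    mxh ((f \o @homothety _ c : hom _ _) + g) = c *: mxh f + mxh g.
  by rewrite mxh_add mxh_homothety.
have [||u uE] := @mx_functional_trace k _ _ S L.
- split=> [|c _ _ [f <-] [g <-]]; last by exists ((f \o @homothety _ c : hom _ _) + g).
  by exists (0 : hom _ _); rewrite mxh0.
- by move=> c _ _ [f <-] [g <-]; rewrite -comb !LE stableD lD -scompE lZ.
have l0 : l 0 = 0 by apply: (addIr (l 0)); rewrite -lD !add0r.
have [|m mE] := @tate_realize a M u.
  (* Norms are stably zero, so the functional kills them; hence [u] has norm zero. *)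
  apply: trace_nondeg => F; rewrite -norm_trace.
  have [f fE] := intertw_mxh (@norm_intertw k G (syz W a) M F).
  rewrite -uE; last by exists f.
  by rewrite -fE LE (_ : stable f = 0) //; apply/stable_eq0_norm; exists F.
exists (stable m) => x; have [f ->] := stable_surj x.
by rewrite mE -LE uE //; exists f.
Qed.

Lemma trace_rotate m n p q (A : 'M[k]_(m, n)) (B : 'M[k]_(n, p)) (C : 'M[k]_(p, q))
    (D : 'M[k]_(q, m)) :
  \tr (A *m B *m C *m D) = \tr (B *m (C *m D *m A)).
Proof. by rewrite -!mulmxA mxtrace_mulC !mulmxA. Qed.

Lemma mxh_eq (M N : fdmod) (f g : M -> N) : f =1 g -> mxh f = mxh g.
Proof. by move=> /funext ->. Qed.

(* With Z = prj_b z inc_a, a map between projectives and hence a norm, both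
   sides are traces against Z, and their difference is the trace of Z against
   h theta_b - theta_a h, whose norm vanishes. *)
Lemma tate_trace_Omega a b (y : shom (syz W a) (syz W b)) y'
    (z : shom (syz W b) (syz W (a + 1))) :
  is_Omega y y' -> tate_trace (scomp y' z) = tate_trace (scomp z y).
Proof.
move=> [f [h [g [-> -> hi fq]]]]; have [z0 ->] := stable_surj z.
have HI : mxh (syz_inc W a) *m mxh h = mxh g *m mxh (syz_inc W b).
  by rewrite -!mxh_comp; try exact: linear_klinear; apply: mxh_eq.
have QF : mxh (syz_prj W a) *m mxh f = mxh h *m mxh (syz_prj W b).
  by rewrite -!mxh_comp; try exact: linear_klinear; apply: mxh_eq.
pose Z := mxh (syz_prj W b) *m mxh z0 *m mxh (syz_inc W a).
rewrite !scompE !tate_traceE.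
rewrite (mxh_comp (@linear_klinear _ _ _ _ g) (@linear_klinear _ _ _ _ z0)).
rewrite (mxh_comp (@linear_klinear _ _ _ _ z0) (@linear_klinear _ _ _ _ f)).
transitivity (\tr (mxh h *m cover_norm b *m Z)).
  rewrite -mulmxA mxtrace_mulC /tate_mx !mulmxA -HI.
  by rewrite -[X in X *m mxh (syz_prj W b)]mulmxA [LHS]trace_rotate !mulmxA.
transitivity (\tr (cover_norm a *m mxh h *m Z)); last first.
  rewrite [RHS]mxtrace_mulC /tate_mx !mulmxA.
  rewrite -[X in _ = \tr (X *m mxh z0)]mulmxA QF.
  by rewrite !mulmxA -[in RHS](mulmxA (mxh (syz_inc W a))) [RHS]trace_rotate !mulmxA.
apply/eqP; rewrite -subr_eq0 -linearB /= -mulmxBl; apply/eqP.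
have -> : Z = norm (Z *m cover_norm a).
  rewrite norm_mull ?cover_normP ?mulmx1 // /Z => t.
  rewrite !mulmxA mxh_intertw -!mulmxA (mulmxA (act _ _)) mxh_intertw.
  by rewrite -!mulmxA mxh_intertw.
rewrite -norm_trace.
suff -> : norm (mxh h *m cover_norm b - cover_norm a *m mxh h) = 0.
  by rewrite mul0mx linear0.
rewrite addrC -scaleN1r norm_is_linear norm_mulr ?norm_mull; try exact: mxh_intertw.
by rewrite !cover_normP mulmx1 mul1mx scaleN1r addNr.
Qed.

(** Projectivity of [cover W a] lifts the map to the covers, and the lift restricts to the
    kernels. *)
Lemma Omega_exists a b (x : shom (syz W a) (syz W b)) : exists y, is_Omega x y.
Proof.
have [f xf] := stable_surj x; have [_ kerb qbsurj] := @syz_exact k G W b.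
have [_ kera _] := @syz_exact k G W a.
have [h hE] := @cover_proj k G W a _ _ (syz_prj W b) (f \o syz_prj W a) qbsurj.
have [|g gE] := @short_exact_factor _ _ _ _ _ (@syz_exact k G W b) (syz W (a + 1))
    (mxh (h \o syz_inc W a)) (mxh_intertw _).
  rewrite -mxh_comp; try exact: linear_klinear.
  rewrite (mxh_eq (fun u => hE (syz_inc W a u))) /=.
  apply: mxh_unique => u; rewrite mulmx0 /=.
  have /kera -> : exists v, syz_inc W a v = syz_inc W a u by exists u.
  by rewrite raddf0 co0.
exists (stable g), f, h, g; split=> //.
by apply: mxh_inj; rewrite -gE [RHS]mxh_comp; try exact: linear_klinear.
Qed.

(* Here the middle map is extended along the inclusion using that the
   projective cover W b is relatively injective. *)
Lemma Omega_inverse a b (y : shom (syz W (a + 1)) (syz W (b + 1))) :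
  exists x : shom (syz W a) (syz W b), is_Omega x y.
Proof.
have [g yg] := stable_surj y; have exa := @syz_exact k G W a.
pose E := mxh g *m mxh (syz_inc W b).
(* The pseudo-inverse extends [E] only k-linearly. Inserting [cover_norm b], of norm one, and taking
   the norm gives a kG-linear map that still restricts to [E]. *)
pose H := norm (pinvmx (mxh (syz_inc W a)) *m (E *m cover_norm b)).
have Eg : intertw E.
  by move=> t; rewrite /E mulmxA mxh_intertw -!mulmxA mxh_intertw.
have IH : mxh (syz_inc W a) *m H = E.
  rewrite -norm_mull; last exact: mxh_intertw.
  rewrite mulmxA mulmxVp ?mul1mx; last exact: short_exact_inc_free exa.
  by rewrite norm_mull // cover_normP mulmx1.
have [h hE] := intertw_mxh (@norm_intertw k G _ _
  (pinvmx (mxh (syz_inc W a)) *m (E *m cover_norm b))).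
have [|f fE] := @short_exact_extend _ _ _ _ _ exa (syz W b)
    (mxh (syz_prj W b \o h)) (mxh_intertw _).
  rewrite [X in _ *m X]mxh_comp; try exact: linear_klinear.
  rewrite hE -/H mulmxA IH /E -mulmxA (short_exact_comp0 (@syz_exact k G W b)).
  by rewrite mulmx0.
exists (stable f), f, h, g; split=> //; apply: mxh_inj.
  rewrite [LHS]mxh_comp; try exact: linear_klinear.
  by rewrite [RHS]mxh_comp; try exact: linear_klinear; rewrite hE -/H IH.
by rewrite [LHS]mxh_comp; try exact: linear_klinear; rewrite fE.
Qed.

End TateDuality.

(** * Graded homomorphisms, compatible pairs and fullness *)

Section Fullness.
Variables (k : fieldType) (G : finGroupType) (W : syzygies k G).
Notation fdmod := (fdmod k G).
Notation hom := Defs.hom.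

(** Induction on [a] in both directions, using [Omega_inverse] upwards and [Omega_exists] downwards.
    The index [c] with its equation avoids transport between [a + 1 + j] and [a + j + 1]. *)
Lemma is_Omega_pow_exists (a c j : int) (y : shom (syz W c) (syz W a)) :
  c = a + j -> exists f : tate W (triv k G) j, is_Omega_pow f y.
Proof.
pose P a := forall (c j : int) (y : shom (syz W c) (syz W a)), c = a + j ->
  exists f : tate W (triv k G) j, is_Omega_pow f y.
have Psucc b : P b -> P (b + 1).
  move=> Pb d i z; rewrite addrAC => di.
  subst d; have [x xz] := Omega_inverse z.
  have [f fx] := Pb _ i x erefl.
  by exists f; apply: Omega_pow_succ fx.
have Ppred b : P (b + 1) -> P b.
  move=> Pb d i z di; have [z' zz'] := Omega_exists z.
  have [|f fz'] := Pb _ i z'; first by rewrite di addrAC.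
  by exists f; apply: Omega_pow_pred fz'.
suff : P a by apply.
elim/int_ind: a {c j y} => [|n Pn|n Pn].
- move=> c j y; rewrite add0r => cj; subst c.
  by exists (scomp (stable (syz0 W)) y); apply: Omega_pow_zero.
- by rewrite -addn1 PoszD; apply: Psucc.
- by apply: Ppred; rewrite -addn1 PoszD opprD subrK.
Qed.

Section GradedHom.
Variables (M N : fdmod) (phi : graded_hom W M N).

(** Every map between syzygies is some Omega^a f, so compatibility with the ring action is
    naturality in all of them. *)
Lemma graded_hom_natural a c (x : tate W M a) (y : shom (syz W c) (syz W a)) :
  phi c (scomp x y) = scomp (phi a x) y.
Proof.
have [j cE] : exists j, c = a + j by exists (c - a); rewrite addrC subrK.
subst c; have [f fy] := is_Omega_pow_exists y erefl.
exact: graded_act fy.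
Qed.

Definition compatible (J : fdmod) (beta : shom N J) (m : shom M J) : Prop :=
  forall a (x : tate W M a), scomp m x = scomp beta (phi a x).

(** Use the direct sum and recover each equation by projecting. With [g] the identity this concerns
    solutions of the pairs; with [g] zero, the homogeneous equations. *)
Lemma compatible_pair J1 J2 (b1 : shom N J1) (b2 : shom N J2) m1 m2 :
    compatible b1 m1 -> compatible b2 m2 ->
  exists (J : fdmod) (b : shom N J) (m : shom M J),
    compatible b m /\ forall L (f : shom L N) (g : shom L M),
      scomp b f = scomp m g -> scomp b1 f = scomp m1 g /\ scomp b2 f = scomp m2 g.
Proof.
move=> bm1 bm2; pose J := fdpair J1 J2.
pose i1 : shom J1 J := stable (@pair_inl _ J1 J2 : {linear J1 -> J}).
pose i2 : shom J2 J := stable (@pair_inr _ J1 J2 : {linear J2 -> J}).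
pose p1 : shom J J1 := stable (fst : {linear J -> J1}).
pose p2 : shom J J2 := stable (snd : {linear J -> J2}).
have p1i1 : scomp p1 i1 = stable (idfun : {linear J1 -> J1}).
  by rewrite /p1 /i1 scompE; apply: stable_ext.
have p2i2 : scomp p2 i2 = stable (idfun : {linear J2 -> J2}).
  by rewrite /p2 /i2 scompE; apply: stable_ext.
have p1i2 : scomp p1 i2 = 0.
  rewrite /p1 /i2 scompE -[RHS]stable0.
  exact: stable_ext.
have p2i1 : scomp p2 i1 = 0.
  rewrite /p2 /i1 scompE -[RHS]stable0.
  exact: stable_ext.
have p1E K L (u : shom K L) (v1 : shom L J1) (v2 : shom L J2) :
    scomp p1 (scomp (scomp i1 v1 + scomp i2 v2) u) = scomp v1 u.
  by rewrite scompA scompDr !scompA p1i1 p1i2 scomp1x scomp0x addr0.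
have p2E K L (u : shom K L) (v1 : shom L J1) (v2 : shom L J2) :
    scomp p2 (scomp (scomp i1 v1 + scomp i2 v2) u) = scomp v2 u.
  by rewrite scompA scompDr !scompA p2i1 p2i2 scomp1x scomp0x add0r.
exists J, (scomp i1 b1 + scomp i2 b2), (scomp i1 m1 + scomp i2 m2); split.
  by move=> a x; rewrite !scompDl -!scompA bm1 bm2.
move=> L f g fg; split.
  by rewrite -(p1E _ _ f b1 b2) fg p1E.
by rewrite -(p2E _ _ f b1 b2) fg p2E.
Qed.

Lemma compatible_realize (J : fdmod) (beta : shom N J) (m : shom M J) :
    generating_hypothesis W -> compatible beta m ->
  exists f : shom M N, scomp beta f = m.
Proof.
move=> GH bm; have [C [c [cb lift]]] := weak_cokernel beta.
by apply: lift; apply: GH => a x; rewrite -scompA bm scompA cb scomp0x.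
Qed.

(** Duality gives [m] with the right traces in degree [a]. A discrepancy in degree [b] would be
    detected by some Omega y; rotating the trace turns it into a discrepancy at [scomp x y], in
    degree [a]. *)
Lemma compatible_trace a (beta : shom N (syz W (a + 1))) :
  exists m : shom M (syz W (a + 1)), compatible beta m.
Proof.
have [||m mP] := @tate_represent k G W a M (fun x => tate_trace (scomp beta (phi a x))).
- by move=> x y; rewrite raddfD scompDr tate_traceD.
(* [phi] is only assumed additive; k-linearity comes from naturality along homotheties. *)
- move=> c x; rewrite graded_hom_natural scompA.
  have [f ->] := stable_surj (scomp beta (phi a x)).
  by rewrite scompE !tate_traceE mxh_homothety -scalemxAl linearZ.
exists m => b x; apply: contrapT => nz.
have [|m'] := @tate_detect k G W b _ (scomp m x - scomp beta (phi b x)).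
  by move=> /eqP; rewrite subr_eq0 => /eqP.
have [y ym'] := Omega_inverse m'.
rewrite (tate_trace_Omega _ ym') scompDl scompNl -!scompA -graded_hom_natural.
have := mP (scomp x y).
by rewrite tate_traceD tate_traceN => ->; rewrite subrr eqxx.
Qed.

(** The solutions are actual homomorphisms, not stable classes, so that their dimension is a matrix
    rank. *)
Lemma mxh_solutions_subspace (J : fdmod) (beta : shom N J) :
  subspace (fun v : 'rV[k]_(dimv M * dimv N) =>
    exists f : hom M N, v = mxvec (mxh f) /\ scomp beta (stable f) = 0).
Proof.
split=> [|c u v [f [-> f0]] [g [-> g0]]].
  exists (0 : hom M N); rewrite mxh0 linear0.
  by rewrite stable0 scompx0.
exists ((f \o @homothety _ _ M c : hom M N) + g); split.
  by rewrite mxh_add mxh_homothety linearP.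
by rewrite stableD scompDr g0 -scompE scompA f0 scomp0x addr0.
Qed.

(* Among all compatible pairs choose one for which the space of f with
   beta f = 0 has minimal dimension: a solution of beta f = m then solves
   every other compatible pair, as one sees by pairing the two. *)
Lemma compatible_simultaneous :
  generating_hypothesis W ->
  exists f : shom M N, forall (J : fdmod) (beta : shom N J) (m : shom M J),
    compatible beta m -> scomp beta f = m.
Proof.
move=> GH.
pose sol J (beta : shom N J) := sval (cid (subspace_mx (mxh_solutions_subspace beta))).
have solP J (beta : shom N J) v : (v <= sol J beta)%MS <->
    exists f : hom M N, v = mxvec (mxh f) /\ scomp beta (stable f) = 0.
  by rewrite -(svalP (cid (subspace_mx (mxh_solutions_subspace beta))) v).
pose P d := `[< exists (J : fdmod) (beta : shom N J) (m : shom M J),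
  compatible beta m /\ \rank (sol J beta) = d >].
have exP : exists d, P d.
  (* The zero pair is compatible, so a minimal rank exists. *)
  exists (\rank (sol N (0 : shom N N))); apply/asboolP.
  by exists N, 0, 0; split=> // a x; rewrite !scomp0x.
case: (ex_minnP exP) => d /asboolP[J [beta [m [bm rkd]]]] mind.
have [f fm] := compatible_realize GH bm; exists f => J' beta' m' bm'.
have [K [b [n [bn pairP]]]] := compatible_pair bm bm'.
have [f' f'n] := compatible_realize GH bn.
have [|bf' b'f'] := pairP _ f' (stable (idfun : {linear M -> M})).
  by rewrite scompx1.
rewrite !scompx1 in bf' b'f'.
have le_sol : (sol K b <= sol J beta)%MS.
  apply/row_subP => j; have /solP[g [-> bg]] := row_sub j (sol K b).
  have [|bg0 _] := pairP _ (stable g) (0 : shom M M); first by rewrite scompx0.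
  by apply/solP; exists g; rewrite bg0 scompx0.
have ge_sol : (sol J beta <= sol K b)%MS.
  rewrite -(mxrank_leqif_sup le_sol) eqn_leq mxrankS //= rkd.
  by apply: mind; apply/asboolP; exists K, b, n.
(* Both [f] and [f'] solve the first pair, so their difference is killed by [beta], hence by [b]
   since the two solution spaces agree, hence by [beta']. *)
have [g gE] := stable_surj (f' - f).
have /solP[g' [/(can_inj mxvecK) gg' bg']] : (mxvec (mxh g) <= sol K b)%MS.
  apply: submx_trans ge_sol; apply/solP; exists g; split=> //.
  by rewrite -gE scompDr scompNr bf' fm subrr.
have [|_ b'g] := pairP _ (stable g') (0 : shom M M); first by rewrite scompx0.
move: b'g; rewrite (stable_ext (mxh_inj (esym gg'))) -gE scompx0 scompDr scompNr b'f'.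
by move=> /eqP; rewrite subr_eq0 => /eqP.
Qed.

Lemma graded_hom_realize :
  generating_hypothesis W ->
  exists f : shom M N, forall i (x : tate W M i), phi i x = scomp f x.
Proof.
move=> GH; have [f fP] := compatible_simultaneous GH; exists f => i x.
apply: contrapT => nz.
have [|beta] := @tate_detect k G W i _ (phi i x - scomp f x).
  by move=> /eqP; rewrite subr_eq0 => /eqP.
have [m bm] := compatible_trace beta.
rewrite scompDr scompNr scompA (fP _ _ _ bm) bm subrr.
by rewrite tate_trace0 eqxx.
Qed.

End GradedHom.
End Fullness.

Theorem theorem3p3 (p : nat) (G : finGroupType) (k : fieldType)
    (W : syzygies k G) :
  prime p -> (p.-group [set: G])%g -> (p \in [pchar k])%R ->
  generating_hypothesis W -> tate_full W.
Proof. by move=> _ _ _ GH M N phi; apply: graded_hom_realize. Qed.
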